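(* Let $0<\alpha<\beta<1$ and $\gamma\in(0,\infty)$, and consider the asymptotic regime $m=m(n)$ with $m/n\to\gamma$ as $n\to\infty$. For each $m$ let $\mathcal{D}_m$ be a family of continuous joint distributions on $\mathbb{R}^m$ containing all (nondegenerate) $m$-variate Gaussian distributions, and for $\epsilon>0$ let $\mathcal{D}_m(\|\Theta_\tau\|_2\ge\epsilon)=\{D\in\mathcal{D}_m:\|\Theta_\tau\|_2\ge\epsilon\}$. Then there exist constants $C_i=C_i(\alpha,\beta,\gamma)>0$, $i=1,2$, such that (i) $\displaystyle\liminf_{n\to\infty}\ \inf_{\mathcal{D}_m(\|\Theta_\tau\|_2\ge\epsilon_n)}\mathbb{E}[\phi_\alpha(S_\tau)]>\beta$ for $\epsilon_n=C_1\sqrt n$, and (ii) $\displaystyle\liminf_{n\to\infty}\ \inf_{\mathcal{D}_m(\|\Theta_\tau\|_2\ge\epsilon_n)}\mathbb{E}[\phi_\alpha(T_\tau)]>\beta$ for $\epsilon_n=C_2\sqrt n$.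
   Context: $\mathbf X_1,\dots,\mathbf X_n$ are i.i.d. copies of $\mathbf X=(X^{(1)},\dots,X^{(m)})$ with distribution $D$ on $\mathbb{R}^m$; $\mathbf X_i=(X_i^{(1)},\dots,X_i^{(m)})$, and expectations are under $D$. For $p\neq q$ and sample indices $i\neq j$ let $$h^{(pq)}_{\{i,j\}}=\mathrm{sgn}\big((X_i^{(p)}-X_j^{(p)})(X_i^{(q)}-X_j^{(q)})\big)$$ (Kendall kernel), $\tau^{(pq)}=\binom n2^{-1}\sum_{1\le i<j\le n}h^{(pq)}_{\{i,j\}}$ (sample Kendall's tau), $\theta_\tau^{(pq)}=\mathbb{E}[h^{(pq)}_{\{1,2\}}]$, and $\Theta_\tau=(\theta_\tau^{(pq)})_{1\le p<q\le m}\in\mathbb{R}^{\binom m2}$ with Euclidean norm $\|\Theta_\tau\|_2$. Statistics: $$S_\tau=\sum_{1\le p<q\le m}\big(\tau^{(pq)}\big)^2-\binom m2\mu_\tau,\qquad \mu_\tau=\frac{2(2n+5)}{9n(n-1)},$$ $$T_\tau=\sum_{1\le p<q\le m}\binom n4^{-1}\sum_{\substack{A\subset\{1,\dots,n\}\\|A|=4}}\frac16\sum_{\substack{B\subset A\\|B|=2}}h^{(pq)}_{B}\,h^{(pq)}_{A\setminus B}.$$ ($\mu_\tau$ is the expectation of $(\tau^{(pq)})^2$ when $X^{(p)},X^{(q)}$ are independent; $T_\tau$ is an unbiased estimator of $\|\Theta_\tau\|_2^2$.) Tests: with $z_{1-\alpha}$ the $(1-\alpha)$-quantile of $\mathcal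 N(0,1)$, $\phi_\alpha(S_\tau)=1$ (reject independence) if $S_\tau\ge\frac{4m}{9n}z_{1-\alpha}$ and $0$ otherwise; $\phi_\alpha(T_\tau)=1$ if $T_\tau\ge\frac{4m}{9n}z_{1-\alpha}$ and $0$ otherwise. These have asymptotic size $\alpha$ under independence of $X^{(1)},\dots,X^{(m)}$. *)

(* Defs.v *)
From HB Require Import structures.
From mathcomp Require Import all_boot all_order all_algebra.
From mathcomp Require Import all_classical all_reals all_analysis.

Set Implicit Arguments.
Unset Strict Implicit.
Unset Printing Implicit Defensive.

Import Order.TTheory GRing.Theory Num.Theory.
Import numFieldNormedType.Exports.

Local Open Scope classical_set_scope.
Local Open Scope ring_scope.

(* A point of R^m is an m.-tuple R, with the product sigma-algebra, which is
   the Borel one. *)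

Section iid_law.
Context d (T : measurableType d) (R : realType) (D : probability T R).

Definition tuple_cons n (z : T * n.-tuple T) : n.+1.-tuple T :=
  [tuple of z.1 :: z.2].

Lemma measurable_tuple_cons n : measurable_fun [set: T * n.-tuple T] (@tuple_cons n).
Proof. exact: measurable_cons. Qed.

HB.instance Definition _ n := @isMeasurableFun.Build _ _ _ _
  (@tuple_cons n) (@measurable_tuple_cons n).

(* The joint law of n independent variables with law D, i.e. the n-fold product
   measure. *)
Fixpoint iid_law (n : nat) : probability (n.-tuple T) R :=
  match n with
  | 0 => \d_ [tuple]
  | k.+1 => distribution (D \x iid_law k)%E (@tuple_cons k)
  end.

Lemma iid_law_box n (A : 'I_n -> set T) : (forall i, measurable (A i)) ->
  iid_law n [set x | forall i, A i (tnth x i)] = (\prod_(i < n) D (A i))%E.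
Proof.
elim: n A => [|n IH] A mA.
  by rewrite big_ord0 /= diracE mem_set// => -[].
have mB : measurable [set x : n.-tuple T | forall i, A (lift ord0 i) (tnth x i)].
  rewrite (_ : mkset _ =
    \bigcap_(i in [set: 'I_n]) ((@tnth n T ^~ i) @^-1` A (lift ord0 i))).
    apply: fin_bigcap_measurable => [|i _]; first exact: finite_finset.
    rewrite -[X in measurable X]setTI.
    exact: measurable_tnth.
  by apply/seteqP; split => x /= Ax i; [move=> _|]; exact: Ax.
rewrite big_ord_recl -IH// -product_measure1E//.
congr (product_measure1 _ _ _); apply/seteqP; split => -[x y] /=.
  move=> Ax; split=> [|i]; first by have := Ax ord0; rewrite tnth0.
  by have := Ax (lift ord0 i); rewrite tnthS.
move=> [Ax Ay] i; case: (unliftP ord0 i) => [j|] ->.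
  by rewrite tnthS; exact: Ay.
by rewrite tnth0.
Qed.

End iid_law.

Section population.
Context {R : realType} {m : nat}.
Implicit Types (D : probability (m.-tuple R) R) (x y : m.-tuple R).

Definition joint_cdf D (x : 'rV[R]_m) : R :=
  fine (D [set y | forall i, tnth y i <= x ord0 i]).

Definition continuous_distribution D := continuous (joint_cdf D).

Definition posdef (Sigma : 'M[R]_m) :=
  Sigma^T = Sigma /\
  forall a : 'rV[R]_m, a != 0 -> 0 < (a *m Sigma *m a^T) ord0 ord0.

(* N(mu, Sigma) is the law all of whose nontrivial linear forms a.X are
   N(a.mu, a Sigma a^T); the last argument of normal_prob is the standard
   deviation. *)
Definition nondegenerate_gaussian D :=
  exists (mu : 'rV[R]_m) (Sigma : 'M[R]_m), posdef Sigma /\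
  forall a : 'rV[R]_m, a != 0 -> forall B : set R, measurable B ->
    D [set x | B (\sum_i a ord0 i * tnth x i)] =
    normal_prob ((a *m mu^T) ord0 ord0)
                (Num.sqrt ((a *m Sigma *m a^T) ord0 ord0)) B.

Definition kendall (p q : 'I_m) x y : R :=
  Num.sg ((tnth x p - tnth y p) * (tnth x q - tnth y q)).

Definition theta_tau D (p q : 'I_m) : R :=
  fine 'E_((D \x D)%E)[fun z => kendall p q z.1 z.2].

Definition norm_Theta D : R :=
  Num.sqrt (\sum_(p < m) \sum_(q < m | (p < q)%N) theta_tau D p q ^+ 2).

End population.

Section statistics.
Context {R : realType} {m n : nat}.
Implicit Types (X : n.-tuple (m.-tuple R)) (p q : 'I_m).

(* h_B for B = {i, j}: the sum has the single term with i < j. *)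
Definition h X p q (B : {set 'I_n}) : R :=
  \sum_(i in B) \sum_(j in B | (i < j)%N) kendall p q (tnth X i) (tnth X j).

Lemma h_set2 X p q (i j : 'I_n) : i != j ->
  h X p q [set i; j] = kendall p q (tnth X i) (tnth X j).
Proof.
have aux (k l : 'I_n) : (k < l)%N ->
    h X p q [set k; l] = kendall p q (tnth X k) (tnth X l).
  move=> kl; have kNl : k != l by rewrite -val_eqE/= ltn_eqF.
  rewrite /h big_setU1 ?inE//= big_set1.
  rewrite !big_mkcondr /= !big_setU1 ?inE//= !big_set1.
  by rewrite !ltnn kl ltnNge (ltnW kl)/= !addr0 add0r.
case: (ltngtP i j) => [/aux//| ji _|/val_inj ->]; last by rewrite eqxx.
rewrite finset.setUC aux// /kendall; congr Num.sg.
by rewrite -[LHS]mulrNN !opprB.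
Qed.

Definition tau X p q : R :=
  ('C(n, 2)%:R)^-1 * \sum_(i < n) \sum_(j < n | (i < j)%N) h X p q [set i; j].

Definition mu_tau : R :=
  (2 * (2 * n%:R + 5)) / (9 * n%:R * (n%:R - 1)).

Definition S_tau X : R :=
  (\sum_(p < m) \sum_(q < m | (p < q)%N) tau X p q ^+ 2) - 'C(m, 2)%:R * mu_tau.

Definition T_tau X : R :=
  \sum_(p < m) \sum_(q < m | (p < q)%N)
    ('C(n, 4)%:R)^-1 *
      \sum_(A : {set 'I_n} | #|A| == 4)
        6^-1 * \sum_(B : {set 'I_n} | (B \subset A) && (#|B| == 2))
                 h X p q B * h X p q (A :\: B).

End statistics.

Definition normal_quantile {R : realType} (u : R) : R :=
  inf [set x : R | (u%:E <= normal_prob 0 1 `]-oo, x])%E].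

Definition test {R : realType} {m n : nat} (alpha : R)
    (W : n.-tuple (m.-tuple R) -> R) (X : n.-tuple (m.-tuple R)) : R :=
  if 4 * m%:R / (9 * n%:R) * normal_quantile (1 - alpha) <= W X then 1 else 0.

Definition worst_power {R : realType} {m : nat} (n : nat)
    (F : set (probability (m.-tuple R) R)) (alpha epsilon : R)
    (W : n.-tuple (m.-tuple R) -> R) : \bar R :=
  ereal_inf [set ('E_(iid_law D n)[test alpha W])%E |
             D in [set D | F D /\ epsilon <= norm_Theta D]].

(* Main.v *)
Require Import Defs.
From mathcomp Require Import all_boot all_order all_algebra.
From mathcomp Require Import all_classical all_reals all_analysis.
From mathcomp Require Import ring lra measurable_realfun.

Import Order.TTheory GRing.Theory Num.Theory.
Import numFieldNormedType.Exports.

(* The regime is so far from the null that crude bounds suffice.  The kernels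
   h_B and h_B' are uncorrelated when B and B' are disjoint, and a pair of
   2-subsets meets with probability at most 4/n, so E(tau - theta)^2 <= 16/n for
   every pair (p,q); summing over the O(n^2) pairs, the squared Euclidean
   distance from the vector tau to Theta has expectation O(n).  By Markov it is
   at most K n with probability close to 1, and then |tau|^2 exceeds
   |Theta|^2 / 2 - K n.  S and T are never more than O(n) below |tau|^2: for T,
   because the product of two kernels over disjoint 2-subsets differs from
   tau^2 only through the few overlapping pairs.  Hence |Theta|^2 >= C^2 n with
   C large forces S, T >= n, while the rejection threshold stays bounded. *)

Local Open Scope ring_scope.

(** * Counting 2-subsets of the sample indices *)

Section two_subsets.
Context {n : nat}.
Implicit Types (B : {set 'I_n}).

(** Every 2-subset is [[set i; j]] for exactly one pair with [i < j]. Sums over sets are convenient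
    because the disjointness of [B] and [B'] is then easy to state. *)
Lemma sum_pairs (V : nmodType) (F : {set 'I_n} -> V) :
  \sum_(i < n) \sum_(j < n | (i < j)%N) F [set i; j]%SET =
  \sum_(B : {set 'I_n} | #|B| == 2) F B.
Proof.
rewrite pair_big_dep /=.
pose A := [set p : 'I_n * 'I_n | (p.1 < p.2)%N]%SET.
have AE : [set B : {set 'I_n} | #|B| == 2]%SET =
    [set [set p.1; p.2]%SET | p in A]%SET.
  apply/setP => B; rewrite inE.
  apply/cards2P/imsetP => [[i [j [ij ->]]]|[[i j]]]; last first.
    by rewrite inE /= => ij ->; exists i, j; rewrite -val_eqE /= ltn_eqF.
  have [ij'|ji|/val_inj ji] := ltngtP i j; last by rewrite ji eqxx in ij.
    by exists (i, j) => //; rewrite inE.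
  by exists (j, i); [rewrite inE|rewrite finset.setUC].
have -> : \sum_(B : {set 'I_n} | #|B| == 2) F B =
    \sum_(B in [set B : {set 'I_n} | #|B| == 2]%SET) F B.
  by apply: eq_bigl => B; rewrite inE.
rewrite AE big_imset /=; last first.
  move=> [i j] [k l]; rewrite !inE /= => ij kl /setP ijkl.
  move: (ijkl i) (ijkl j) (ijkl k) (ijkl l); rewrite !inE !eqxx !orbT /=.
  move=> /esym/orP[] /eqP iE /esym/orP[] /eqP jE; subst => //.
  - by rewrite ltnn in ij.
  - by move: (ltn_trans ij kl); rewrite ltnn.
  - by rewrite ltnn in ij.
by apply: eq_bigl => p; rewrite inE.
Qed.

(** The map (A, B) -> (B, A \ B) is a bijection onto the ordered pairs of disjoint 2-subsets, with
    inverse (B, B') -> (B u B', B). This rewrites the sum over 4-subsets in [T_tau]. *)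
Lemma sum_disjoint_pairs (V : nmodType) (F : {set 'I_n} -> {set 'I_n} -> V) :
  \sum_(A : {set 'I_n} | #|A| == 4)
    \sum_(B : {set 'I_n} | (B \subset A) && (#|B| == 2)) F B (A :\: B)%SET =
  \sum_(B : {set 'I_n} | #|B| == 2)
    \sum_(B' : {set 'I_n} | (#|B'| == 2) && [disjoint B & B']) F B B'.
Proof.
rewrite !pair_big_dep /=.
rewrite (reindex_onto (fun p => (p.1 :|: p.2, p.1)%SET)
  (fun p => (p.2, p.1 :\: p.2)%SET)) /=; last first.
  move=> [A B] /= /and3P[_ BA _].
  by congr pair; rewrite -[RHS](finset.setID A B) (finset.setIidPr BA).
apply: eq_big => -[B B'] /=; last first.
  by move=> /andP[_ /eqP[->]].
rewrite finset.subsetUl /= finset.setDUl finset.setDv finset.set0U.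
rewrite xpair_eqE eqxx /=.
have -> : (B' :\: B == B')%SET = [disjoint B & B'].
  by rewrite disjoint_sym; apply/eqP/finset.setDidPl.
case dBB': [disjoint B & B']; rewrite ?andbF// !andbT.
rewrite cardsU (disjoint_setI0 dBB') cards0 subn0 andbC.
by case: eqP => [->|]; rewrite ?andbT ?andbF//= -(eqn_add2l 2).
Qed.

(** The admissible [B'] are the 2-subsets of the complement of [B]. *)
Lemma card_disjoint_pairs B : #|B| = 2 ->
  #|[set B' : {set 'I_n} | (#|B'| == 2) && [disjoint B & B']]%SET| =
  'C(n - 2, 2).
Proof.
move=> B2; have -> : (n - 2)%N = #|~: B|%SET.
  by rewrite cardsCs finset.setCK card_ord B2.
rewrite -cards_draws; apply: eq_card => B'; rewrite !inE andbC.
by rewrite disjoint_sym finset.disjoints_subset.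
Qed.
End two_subsets.

(** Both sides count the ordered pairs of disjoint 2-subsets, the left one by choosing their union
    first. The proof multiplies by 4 and compares falling factorials. *)
Lemma bin4_bin2 n : ('C(n, 4) * 6 = 'C(n, 2) * 'C(n - 2, 2))%N.
Proof.
apply/eqP; rewrite -(eqn_pmul2r (isT : 0 < 4)%N) -mulnA; apply/eqP.
have := bin_ffact n 4; have := bin_ffact n 2; have := bin_ffact (n - 2) 2.
rewrite !ffactnSr !ffactn0 !subn0 !mul1n -!subnDA => h1 h2 h3.
have -> : ('C(n, 2) * 'C(n - 2, 2) * 4 = ('C(n, 2) * 2) * ('C(n - 2, 2) * 2))%N.
  by rewrite mulnACA.
by rewrite h1 h2 [LHS]h3 !mulnA.
Qed.

Lemma natr_bin2 (R : realType) n : ('C(n, 2)%:R : R) = n%:R * (n%:R - 1) / 2.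
Proof.
have := bin_ffact n 2; rewrite !ffactnSr ffactn0 mul1n subn0.
case: n => [|n]; first by rewrite bin0n !mul0r.
rewrite subn1 => /(congr1 (fun k => k%:R : R)); rewrite !natrM /= => h.
by rewrite -[X in X - 1]natr1 addrK -h mulfK// pnatr_eq0.
Qed.

(** * Disjoint against overlapping pairs of 2-subsets *)

Section pairs_of_two_subsets.
Context {R : realType} {n : nat}.
Notation N := ('C(n, 2)%:R : R).
Notation M := ('C(n - 2, 2)%:R : R).

(** This split serves twice: with [g] the centred kernel it gives the variance of [tau], with [g]
    the kernel itself it compares [T_tau] with the squares of [tau]. In both cases the overlapping
    pairs are bounded by their number. *)
Lemma square_sum_pairs (g : {set 'I_n} -> R) :
  (\sum_(B : {set 'I_n} | #|B| == 2) g B) ^+ 2 =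
  \sum_(B : {set 'I_n} | #|B| == 2)
    \sum_(B' : {set 'I_n} | (#|B'| == 2) && [disjoint B & B']) g B * g B' +
  \sum_(B : {set 'I_n} | #|B| == 2)
    \sum_(B' : {set 'I_n} | (#|B'| == 2) && ~~ [disjoint B & B']) g B * g B'.
Proof.
rewrite expr2 mulr_suml -big_split /=; apply: eq_bigr => B _.
by rewrite mulr_sumr [LHS](bigID (fun B' : {set 'I_n} => [disjoint B & B'])).
Qed.

Lemma sum_disjoint_pairs_cst (c : R) :
  \sum_(B : {set 'I_n} | #|B| == 2)
    \sum_(B' : {set 'I_n} | (#|B'| == 2) && [disjoint B & B']) c = N * M * c.
Proof.
rewrite (eq_bigr (fun=> M * c)); last first.
  move=> B /eqP B2; rewrite -(card_disjoint_pairs _ B2) sumr_const mulr_natl.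
  by congr (_ *+ _); apply: eq_card => B'; rewrite inE.
by rewrite sumr_const -[LHS]mulr_natl mulrA -cardsE card_draws card_ord.
Qed.

(** Overlapping pairs are counted by complement, through [square_sum_pairs] at the constant 1: all
    N^2 pairs less the N M disjoint ones. *)
Lemma sum_overlap_pairs_cst (c : R) :
  \sum_(B : {set 'I_n} | #|B| == 2)
    \sum_(B' : {set 'I_n} | (#|B'| == 2) && ~~ [disjoint B & B']) c =
  N * (N - M) * c.
Proof.
have := square_sum_pairs (fun=> 1).
rewrite (eq_bigr (fun=> 1))//.
have -> : \sum_(B : {set 'I_n} | #|B| == 2) (1 : R) = N.
  by rewrite sumr_const -cardsE card_draws card_ord.
rewrite mulr1 sum_disjoint_pairs_cst mulr1 => e.
have {e} : \sum_(B : {set 'I_n} | #|B| == 2)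
    \sum_(B' : {set 'I_n} | (#|B'| == 2) && ~~ [disjoint B & B']) 1 =
    N * (N - M).
  by rewrite mulrBr -expr2 e addrC addKr.
move=> <-; rewrite mulr_suml; apply: eq_bigr => B _.
by rewrite mulr_suml; apply: eq_bigr => B' _; rewrite mul1r.
Qed.

(** The number of 2-subsets meeting a given one is linear in [n], while [N] is quadratic; every
    bound of order 1/n below comes from this. *)
Lemma binB2 : (2 <= n)%N -> N - M = 2 * n%:R - 3.
Proof. by move=> n2; rewrite !natr_bin2 natrB//; field. Qed.

End pairs_of_two_subsets.

Local Open Scope classical_set_scope.
Local Open Scope ring_scope.

(** * Integrals and measurability of bounded real functions *)

Section integration.
Context d (T : measurableType d) (R : realType).

Lemma bounded_measurable_integrable (P : probability T R) (f : T -> R) (M : R) :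
  measurable_fun setT f -> (forall x, `|f x| <= M) ->
  P.-integrable setT (EFin \o f).
Proof.
move=> mf fM; apply: measurable_bounded_integrable => //.
  by apply: (@le_lt_trans _ _ 1%E); [exact: probability_le1|exact: ltry].
exists M; split; first exact: num_real.
by move=> y My x _; apply: le_trans (fM x) _; exact: ltW.
Qed.

Lemma probability_integrable_cst (P : probability T R) (r : R) :
  P.-integrable setT (EFin \o fun=> r).
Proof. exact: (@bounded_measurable_integrable _ _ `|r|). Qed.

Lemma probability_Rintegral_cst (P : probability T R) (r : R) :
  \int[P]_x r = r.
Proof.
rewrite Rintegral_cst// -[RHS]mulr1; congr (_ * _).
by rewrite -[RHS]/(fine 1%E); congr fine; exact: probability_setT.
Qed.

Lemma Rintegral_sum (mu : {measure set T -> \bar R}) (D : set T) (I : Type)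
    (s : seq I) (P : pred I) (f : I -> T -> R) :
  measurable D -> (forall i, mu.-integrable D (EFin \o f i)) ->
  \int[mu]_(x in D) (\sum_(i <- s | P i) f i x) =
  \sum_(i <- s | P i) \int[mu]_(x in D) f i x.
Proof.
move=> mD fi; rewrite /Rintegral sum_fine; last first.
  by move=> i _; apply: (integrable_fin_num mD (fi i)).
rewrite -integral_sum//; congr fine; apply: eq_integral => x _.
by rewrite sumEFin.
Qed.

Lemma measurable_sum_cond (I : Type) (s : seq I) (P : pred I)
    (f : I -> T -> R) :
  (forall i, measurable_fun setT (f i)) ->
  measurable_fun setT (fun x => \sum_(i <- s | P i) f i x).
Proof.
move=> mf; under eq_fun do rewrite big_mkcond.
by apply: measurable_sum => i; case: (P i).
Qed.

Lemma measurable_sgr : measurable_fun setT (@Num.sg R).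
Proof.
apply: nondecreasing_measurable => // x y xy.
case: (sgrP x) => [x0|x0|x0]; case: (sgrP y) => [y0|y0|y0] //; lra.
Qed.
End integration.

(** * Independence: transfer of integrals between product laws *)

Section iid_law_transfer.
Context d (T : measurableType d) (R : realType) (D : probability T R).

Definition box n (A : 'I_n -> set T) : set (n.-tuple T) :=
  [set x | forall i, A i (tnth x i)].

Lemma box_bigcap n (A : 'I_n -> set T) :
  box n A = \bigcap_(i in [set: 'I_n]) ((@tnth n T ^~ i) @^-1` A i).
Proof. by apply/seteqP; split => x /= Ax i; [move=> _|]; exact: Ax. Qed.

Lemma measurable_box n (A : 'I_n -> set T) :
  (forall i, measurable (A i)) -> measurable (box n A).
Proof.
move=> mA; rewrite box_bigcap.
apply: fin_bigcap_measurable => [|i _]; first exact: finite_finset.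
by rewrite -[X in measurable X]setTI; exact: measurable_tnth.
Qed.

(** Boxes are stable under intersection, generate the product sigma-algebra and include the whole
    space, so two finite measures that agree on them are equal. *)
Lemma iid_law_unique n (Q : {measure set (n.-tuple T) -> \bar R}) :
  (forall A, (forall i, measurable (A i)) ->
    Q (box n A) = (\prod_(i < n) D (A i))%E) ->
  forall E, measurable E -> iid_law D n E = Q E.
Proof.
move=> Qbox E mE.
pose G := [set B | exists2 A : 'I_n -> set T,
  (forall i, measurable (A i)) & B = box n A].
apply: (measure_unique G (fun=> setT)) => //.
- apply/seteqP; split => B /=; last first.
    move: B; apply: smallest_sub; first exact: sigma_algebra_measurable.
    by move=> _ [A mA ->]; exact: measurable_box.
  move: B; apply: sub_smallest2r; first exact: smallest_sigma_algebra.
  move=> B; rewrite -bigcup_seq => -[i _].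
  rewrite /preimage_set_system /= => -[A mA <-].
  (* A cylinder over coordinate [i] is the box whose other sides are the whole space. *)
  exists (fun j => if j == i then A else setT); first by move=> j; case: ifP.
  apply/seteqP; split => x /=; first by move=> [_ Ax] j; case: eqP => // ->.
  by move=> /(_ i); rewrite eqxx.
- move=> _ _ [A mA ->] [B mB ->]; exists (fun i => A i `&` B i).
    by move=> i; exact: measurableI.
  apply/seteqP; split => x /=; first by move=> [Ax Bx] i; split; [exact: Ax|exact: Bx].
  by move=> ABx; split => i; case: (ABx i).
- by move=> _; exists (fun=> setT) => //; apply/seteqP; split.
- by rewrite bigcup_const.
- by move=> _ [A mA ->]; rewrite Qbox//; exact: iid_law_box.
- by move=> k; apply: (@le_lt_trans _ _ 1%E); [exact: probability_le1|exact: ltry].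
Qed.

(** The product formula on boxes says that the law of [phi] under [P] is [iid_law D k]; what remains
    is the change of variables formula, with the bound on [F] supplying integrability. *)
Lemma Rintegral_iid_law d' (T' : measurableType d') (P : probability T' R) k
    (phi : T' -> k.-tuple T) (F : k.-tuple T -> R) (M : R) :
  measurable_fun setT phi ->
  (forall A, (forall i, measurable (A i)) ->
    P (phi @^-1` box k A) = (\prod_(i < k) D (A i))%E) ->
  measurable_fun setT F -> (forall x, `|F x| <= M) ->
  \int[iid_law D k]_x F x = \int[P]_x F (phi x).
Proof.
move=> mphi phibox mF FM.
pose phi_m := [the {mfun T' >-> _} of mfun_Sub (mem_set mphi : phi \in mfun)].
rewrite /Rintegral (eq_measure_integral (distribution P phi_m)); last first.
  move=> A mA _; exact: (@iid_law_unique _ (distribution P phi_m)).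
rewrite integral_pushforward//.
  exact/measurable_EFinP.
apply: bounded_measurable_integrable; first exact: measurableT_comp.
by move=> x; exact: FM.
Qed.

(** Distinct coordinates of an i.i.d. sample are again i.i.d.: the preimage of a box is a box in all
    [n] coordinates, and the free coordinates contribute factors 1. *)
Lemma iid_law_marginal_box n k (s : 'I_k -> 'I_n) (A : 'I_k -> set T) :
  injective s -> (forall i, measurable (A i)) ->
  iid_law D n ((fun x => [tuple tnth x (s i) | i < k]) @^-1` box k A) =
  (\prod_(i < k) D (A i))%E.
Proof.
move=> s_inj mA.
(* Injectivity of [s] makes the picked index unique; outside the image of [s] the side is the whole
   space. *)
pose A' j := if [pick i | s i == j] is Some i then A i else setT.
have A's i : A' (s i) = A i.
  by rewrite /A'; case: pickP => [i' /eqP/s_inj ->//|/(_ i)]; rewrite eqxx.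
have mA' j : measurable (A' j) by rewrite /A'; case: pickP.
transitivity (iid_law D n (box n A')).
  congr (iid_law D n _); apply/seteqP; split => x /= Ax.
    move=> j; rewrite /A'; case: pickP => // i /eqP <-.
    by have := Ax i; rewrite tnth_mktuple.
  by move=> i; rewrite tnth_mktuple -A's; exact: Ax.
rewrite [LHS]iid_law_box// (bigID (mem (s @: [set: 'I_k])%SET)) /=.
rewrite [X in (_ * X)%E]big1 ?mule1.
  rewrite big_imset /=; first by apply: eq_big => i; rewrite ?inE ?A's.
  by move=> ? ? _ _; exact: s_inj.
move=> j sj; rewrite /A'; case: pickP => [i /eqP sij|_]; last exact: probability_setT.
by case/imsetP: sj; exists i; rewrite ?inE.
Qed.

(* The laws of (X_i, X_j, X_k, X_l) and of ((Y, Y'), (Z, Z')), flattened, are both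
   iid_law D 4; Fubini is then applied to the second one. *)
Lemma Rintegral_iid_law_pairs n (i j k l : 'I_n) (f g : T * T -> R) (M : R) :
  uniq [:: i; j; k; l] ->
  measurable_fun setT f -> measurable_fun setT g ->
  (forall x, `|f x| <= M) -> (forall x, `|g x| <= M) ->
  \int[iid_law D n]_x (f (tnth x i, tnth x j) * g (tnth x k, tnth x l)) =
  \int[(D \x D)%E]_z f z * \int[(D \x D)%E]_z g z.
Proof.
move=> ijkl mf mg fM gM.
pose F (y : 4.-tuple T) := f (tnth y 0, tnth y 1) * g (tnth y 2, tnth y 3).
have FM y : `|F y| <= M * M by rewrite normrM ler_pM.
have mpair (a b : 'I_4) :
    measurable_fun setT (fun y : 4.-tuple T => (tnth y a, tnth y b)).
  by apply/measurable_fun_pair => /=; exact: measurable_tnth.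
have mF : measurable_fun setT F.
  by apply: measurable_funM; [exact: (measurableT_comp mf)|exact: (measurableT_comp mg)].
pose s := tnth [tuple i; j; k; l].
have s_inj : injective s by apply/tuple_uniqP.
transitivity (\int[iid_law D 4]_y F y).
  rewrite (@Rintegral_iid_law _ _ (iid_law D n) 4
    (fun x => [tuple tnth x (s a) | a < 4]) F (M * M))//.
  - by apply: eq_Rintegral => x _; rewrite /F /= !tnth_mktuple.
  - apply/measurable_fun_tnthP => a /=.
    rewrite (_ : _ \o _ = (@tnth n T)^~ (s a)); first exact: measurable_tnth.
    by apply/funext => x /=; rewrite tnth_mktuple.
  - by move=> A mA; exact: iid_law_marginal_box.
pose psi (z : (T * T) * (T * T)) := [tuple z.1.1; z.1.2; z.2.1; z.2.2].
have Fpsi z : F (psi z) = f z.1 * g z.2 by case: z => -[a b] [c e].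
have mpsi : measurable_fun setT psi.
  apply/measurable_fun_tnthP => a.
  case: a => -[|[|[|[|//]]]] a4.
  - exact: (measurableT_comp measurable_fst measurable_fst).
  - exact: (measurableT_comp measurable_snd measurable_fst).
  - exact: (measurableT_comp measurable_fst measurable_snd).
  - exact: (measurableT_comp measurable_snd measurable_snd).
rewrite (@Rintegral_iid_law _ _ ((D \x D) \x (D \x D))%E 4 psi F (M * M))//.
- have fP : (D \x D)%E.-integrable setT (EFin \o f).
    exact: bounded_measurable_integrable fM.
  have gP : (D \x D)%E.-integrable setT (EFin \o g).
    exact: bounded_measurable_integrable gM.
  rewrite {1}/Rintegral -integral12_prod_meas1; last first.
    apply: (@bounded_measurable_integrable _ _ _ _ _ (M * M)) => [|z]; last exact: FM.
    exact: measurableT_comp.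
  rewrite -RintegralZr//; congr fine; apply: eq_integral => z1 _.
  rewrite /fubini_F -RintegralZl//.
  under eq_integral do rewrite Fpsi/=.
  rewrite /Rintegral fineK//; apply: integrable_fin_num => //.
  apply: (@bounded_measurable_integrable _ _ _ _ _ (M * M)) => [|z].
    exact: measurable_funM.
  by rewrite normrM ler_pM.
- move=> A mA.
  rewrite (_ : _ @^-1` _ = (A 0 `*` A 1) `*` (A 2 `*` A 3)); last first.
    apply/seteqP; split => -[[x y] [z t]] /=.
      by move=> Apsi; do 2 split;
        [exact: (Apsi 0)|exact: (Apsi 1)|exact: (Apsi 2)|exact: (Apsi 3)].
    move=> [[Ax Ay] [Az At]] a; rewrite /psi/=.
    have [->|->|->|->] : [\/ a = 0, a = 1, a = 2 | a = 3].
      by case: a => -[|[|[|[|//]]]] a4;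
      [apply: Or41|apply: Or42|apply: Or43|apply: Or44]; exact: val_inj.
    - exact: Ax.
    - exact: Ay.
    - exact: Az.
    - exact: At.
  rewrite [LHS]product_measure1E; [|exact: measurableX|exact: measurableX].
  have DDE a b : (D \x D)%E (A a `*` A b) = (D (A a) * D (A b))%E.
    exact: product_measure1E.
  rewrite [X in (X * _)%E = _]DDE [X in (_ * X)%E = _]DDE.
  rewrite !big_ord_recl big_ord0 mule1 muleA -!muleA.
  by congr (D (A _) * (D (A _) * (D (A _) * D (A _))))%E; exact: val_inj.
Qed.
End iid_law_transfer.

(** * Kendall kernels, and [T_tau] against the squares of [tau] *)

Section kendall.
Context {R : realType} {m : nat}.
Implicit Types (p q : 'I_m).

Lemma kendall_le1 p q (x y : m.-tuple R) : `|kendall p q x y| <= 1.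
Proof. by rewrite normr_sg; case: eqP. Qed.

Lemma measurable_kendall d (T : measurableType d) p q (f g : T -> m.-tuple R) :
  measurable_fun setT f -> measurable_fun setT g ->
  measurable_fun setT (fun x => kendall p q (f x) (g x)).
Proof.
move=> mf mg; apply: (measurableT_comp (measurable_sgr _)).
have mt i u : measurable_fun setT u ->
    measurable_fun setT (fun x : T => tnth (u x : m.-tuple R) i).
  by move=> mu; exact: (measurableT_comp (measurable_tnth i)).
by apply: measurable_funM; apply: measurable_funB; exact: mt.
Qed.

Section sample.
Context {n : nat}.
Implicit Types (X : n.-tuple (m.-tuple R)).

Lemma h_le1 X p q (B : {set 'I_n}) : #|B| == 2 -> `|h X p q B| <= 1.
Proof. by move=> /cards2P[i [j [ij ->]]]; rewrite h_set2// kendall_le1. Qed.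

Lemma measurable_h p q (B : {set 'I_n}) :
  measurable_fun setT (fun X : n.-tuple (m.-tuple R) => h X p q B).
Proof.
apply: measurable_sum_cond => i; apply: measurable_sum_cond => j.
by apply: measurable_kendall; exact: measurable_tnth.
Qed.

Lemma tauE X p q :
  tau X p q = ('C(n, 2)%:R)^-1 * \sum_(B : {set 'I_n} | #|B| == 2) h X p q B.
Proof. by rewrite /tau sum_pairs. Qed.

Lemma measurable_tau p q :
  measurable_fun setT (fun X : n.-tuple (m.-tuple R) => tau X p q).
Proof.
under eq_fun do rewrite tauE.
apply: measurable_funM => //; apply: measurable_sum_cond => B.
exact: measurable_h.
Qed.

Lemma measurable_S_tau : measurable_fun setT (@S_tau R m n).
Proof.
apply: measurable_funB => //; apply: measurable_sum_cond => p.
apply: measurable_sum_cond => q; apply: measurable_funX; exact: measurable_tau.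
Qed.

Lemma measurable_T_tau : measurable_fun setT (@T_tau R m n).
Proof.
apply: measurable_sum_cond => p; apply: measurable_sum_cond => q.
apply: measurable_funM => //; apply: measurable_sum_cond => A.
apply: measurable_funM => //; apply: measurable_sum_cond => B.
by apply: measurable_funM; exact: measurable_h.
Qed.

(** Let U be the sum of the products over disjoint pairs. Then N^2 tau^2 is U plus N (N - M)
    overlapping products, each at most 1, whereas the right-hand side is U / (N M). Passing from N^2
    to N M costs only a term of order 1/n. *)
Lemma tau_sqr_le X p q : (7 <= n)%N ->
  tau X p q ^+ 2 - 8 / n%:R <=
  ('C(n, 4)%:R)^-1 *
      \sum_(A : {set 'I_n} | #|A| == 4)
        6^-1 * \sum_(B : {set 'I_n} | (B \subset A) && (#|B| == 2))
                 h X p q B * h X p q (A :\: B)%SET.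
Proof.
move=> n7; rewrite -mulr_sumr.
rewrite (sum_disjoint_pairs _ (fun B B' => h X p q B * h X p q B')).
set U := \sum_(B | _) _.
pose N := 'C(n, 2)%:R : R; pose M := 'C(n - 2, 2)%:R : R.
have nR7 : 7 <= n%:R :> R by rewrite (ler_nat R 7).
have NE : N = n%:R * (n%:R - 1) / 2 by exact: natr_bin2.
have ME : M = (n%:R - 2) * (n%:R - 3) / 2.
  by rewrite /M natr_bin2 natrB ?(leq_trans _ n7)//; field.
have N0 : 0 < N by rewrite NE; nra.
have M0 : 0 < M by rewrite ME; nra.
have NM6 : 'C(n, 4)%:R * 6 = N * M :> R by rewrite -natrM bin4_bin2 natrM.
have C4 : 'C(n, 4)%:R != 0 :> R.
  by apply: contra_eq_neq NM6 => ->; rewrite mul0r eq_sym mulf_neq0 ?gt_eqF.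
have -> : 'C(n, 4)%:R^-1 * (6^-1 * U) = U / (N * M).
  by rewrite -NM6; field.
have tauU : N ^+ 2 * tau X p q ^+ 2 - N * (N - M) <= U.
  rewrite -exprMn tauE mulrA mulfV ?gt_eqF// mul1r square_sum_pairs -/U.
  rewrite -addrA gerDl subr_le0 -[leRHS]mulr1 -sum_overlap_pairs_cst.
  apply: ler_sum => B B2; apply: ler_sum => B' /andP[B'2 _].
  by rewrite (le_trans (ler_norm _))// normrM mulr_ile1 ?h_le1.
rewrite ler_pdivlMr ?mulr_gt0//; apply: le_trans tauU.
(* This amounts to 2 n^2 - 17 n + 24 >= 0, which holds at 7 but fails at 6; the assumption [7 <= n]
   originates here. *)
have NM : N - M <= 8 / n%:R * M.
  rewrite binB2 ?(leq_trans _ n7)// ME.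
  have -> : 8 / n%:R * ((n%:R - 2) * (n%:R - 3) / 2) =
      (4 * (n%:R - 2) * (n%:R - 3)) / n%:R :> R.
    by field; rewrite gt_eqF//; lra.
  rewrite ler_pdivlMr; nra.
have MN : M <= N by rewrite -subr_ge0 binB2 ?(leq_trans _ n7)//; lra.
have tau0 : 0 <= tau X p q ^+ 2 by exact: sqr_ge0.
set t := tau X p q ^+ 2 in tau0 *; set e := 8 / _ in NM *.
(* As M <= N and the square is nonnegative, its coefficient N^2 may be lowered to N M. *)
have : 0 <= t * N * (N - M).
  by apply: mulr_ge0; rewrite ?subr_ge0// mulr_ge0// ltW.
have : N * (N - M) <= N * (e * M) by rewrite ler_pM2l.
lra.
Qed.

End sample.
End kendall.

(** * Variance of the sample Kendall's tau *)

Section variance.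
Context {R : realType} {m n : nat} (D : probability (m.-tuple R) R).
Implicit Types (p q : 'I_m) (X : n.-tuple (m.-tuple R)).

Lemma theta_tauE p q :
  theta_tau D p q = \int[(D \x D)%E]_z kendall p q z.1 z.2.
Proof. by rewrite /theta_tau unlock. Qed.

Lemma measurable_kendall_pair p q :
  measurable_fun setT (fun z : m.-tuple R * m.-tuple R => kendall p q z.1 z.2).
Proof. exact: measurable_kendall. Qed.

Lemma integrable_kendall p q :
  (D \x D)%E.-integrable setT (EFin \o fun z => kendall p q z.1 z.2).
Proof.
apply: (@bounded_measurable_integrable _ _ _ _ _ 1).
  exact: measurable_kendall_pair.
by move=> z; exact: kendall_le1.
Qed.

Lemma theta_tau_le1 p q : `|theta_tau D p q| <= 1.
Proof.
rewrite theta_tauE (le_trans (le_normr_Rintegral _ (integrable_kendall p q)))//.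
rewrite -[leRHS](probability_Rintegral_cst _ _ _ (D \x D)%E).
apply: le_Rintegral => //.
- exact/integrable_norm/integrable_kendall.
- exact: probability_integrable_cst.
- by move=> z _; exact: kendall_le1.
Qed.

Definition centered_h p q X (B : {set 'I_n}) : R := h X p q B - theta_tau D p q.

Lemma measurable_centered_h p q B : measurable_fun setT (centered_h p q ^~ B).
Proof. by apply: measurable_funB => //; exact: measurable_h. Qed.

Lemma centered_h_le2 p q X (B : {set 'I_n}) :
  #|B| == 2 -> `|centered_h p q X B| <= 2.
Proof.
move=> B2; rewrite (le_trans (ler_normB _ _))// -[2]/(1 + 1 : R).
by rewrite lerD ?h_le1 ?theta_tau_le1.
Qed.

(** Disjoint 2-subsets involve four different sample points, so the expectation factors into two
    means of the kernel minus [theta_tau], both zero. *)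
Lemma covariance_disjoint p q (B B' : {set 'I_n}) :
  #|B| == 2 -> #|B'| == 2 -> [disjoint B & B']%bool ->
  \int[iid_law D n]_X (centered_h p q X B * centered_h p q X B') = 0.
Proof.
move=> /cards2P[i [j [ij ->]]] /cards2P[k [l [kl ->]]] dBB'.
have [kB lB] : k \notin [set i; j]%SET /\ l \notin [set i; j]%SET.
  by split; rewrite (disjointFl dBB')// !inE eqxx ?orbT.
have ijkl : uniq [:: i; j; k; l].
  move: kB lB; rewrite /= !inE !negb_or kl ij /= !andbT.
  by move=> /andP[ki kj] /andP[li lj]; rewrite !(eq_sym i) !(eq_sym j) ki kj li lj.
pose f (z : m.-tuple R * m.-tuple R) := kendall p q z.1 z.2 - theta_tau D p q.
have mf : measurable_fun setT f.
  by apply: measurable_funB => //; exact: measurable_kendall_pair.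
have f2 z : `|f z| <= 2.
  rewrite (le_trans (ler_normB _ _))// -[2]/(1 + 1 : R).
  by rewrite lerD ?kendall_le1 ?theta_tau_le1.
transitivity (\int[iid_law D n]_X
    (f (tnth X i, tnth X j) * f (tnth X k, tnth X l))).
  by apply: eq_Rintegral => X _; rewrite /centered_h !h_set2.
rewrite (@Rintegral_iid_law_pairs _ _ _ D n i j k l f f 2)//.
have -> : \int[(D \x D)%E]_z f z = 0; last by rewrite mulr0.
rewrite /f RintegralB//; first last.
- exact: probability_integrable_cst.
- exact: integrable_kendall.
by rewrite -theta_tauE probability_Rintegral_cst subrr.
Qed.

Lemma integrable_centered_hM p q (B B' : {set 'I_n}) :
  (iid_law D n).-integrable setT
    (EFin \o fun X => centered_h p q X B * centered_h p q X B').
Proof.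
pose b (C : {set 'I_n}) : R :=
  \sum_(i in C) \sum_(j in C | (i < j)%N) 1 + `|theta_tau D p q|.
have cb X C : `|centered_h p q X C| <= b C.
  rewrite (le_trans (ler_normB _ _))// lerD2r (le_trans (ler_norm_sum _ _ _))//.
  apply: ler_sum => i _; rewrite (le_trans (ler_norm_sum _ _ _))//.
  by apply: ler_sum => j _; exact: kendall_le1.
apply: (@bounded_measurable_integrable _ _ _ _ _ (b B * b B')).
  by apply: measurable_funM; exact: measurable_centered_h.
by move=> X; rewrite normrM ler_pM.
Qed.

(** The deviation of [tau] is the average of the centred kernels. In the expected square the
    disjoint pairs vanish, and each of the N (N - M) overlapping pairs contributes at most 4. *)
Lemma tau_variance p q : (2 <= n)%N ->
  \int[iid_law D n]_X (tau X p q - theta_tau D p q) ^+ 2 <= 16 / n%:R.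
Proof.
move=> n2.
pose N := 'C(n, 2)%:R : R; pose M := 'C(n - 2, 2)%:R : R.
have nR2 : 2 <= n%:R :> R by rewrite (ler_nat R 2).
have NE : N = n%:R * (n%:R - 1) / 2 by exact: natr_bin2.
have N0 : 0 < N by rewrite NE; nra.
pose V (P : {set 'I_n} -> {set 'I_n} -> bool) X : R :=
  \sum_(B : {set 'I_n} | #|B| == 2) \sum_(B' : {set 'I_n} | (#|B'| == 2) && P B B')
    centered_h p q X B * centered_h p q X B'.
have intVB (P : {set 'I_n} -> {set 'I_n} -> bool) B : (iid_law D n).-integrable setT
    (EFin \o fun X => \sum_(B' : {set 'I_n} | (#|B'| == 2) && P B B')
      centered_h p q X B * centered_h p q X B').
  rewrite (_ : _ \o _ = fun X => \sum_(B' : {set 'I_n} | (#|B'| == 2) && P B B')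
      (centered_h p q X B * centered_h p q X B')%:E); last first.
    by apply/funext => X /=; rewrite sumEFin.
  by apply: integrable_sum => // B' _; exact: integrable_centered_hM.
have intV P : (iid_law D n).-integrable setT (EFin \o V P).
  rewrite (_ : _ \o _ = fun X => \sum_(B : {set 'I_n} | #|B| == 2)
      (\sum_(B' : {set 'I_n} | (#|B'| == 2) && P B B')
      centered_h p q X B * centered_h p q X B')%:E); last first.
    by apply/funext => X /=; rewrite sumEFin.
  by apply: integrable_sum => // B _; exact: intVB.
have VE P : \int[iid_law D n]_X V P X =
    \sum_(B : {set 'I_n} | #|B| == 2) \sum_(B' : {set 'I_n} | (#|B'| == 2) && P B B')
    \int[iid_law D n]_X (centered_h p q X B * centered_h p q X B').
  rewrite Rintegral_sum//; apply: eq_bigr => B _; rewrite Rintegral_sum// => B'.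
  exact: integrable_centered_hM.
have tauV X : (tau X p q - theta_tau D p q) ^+ 2 =
    N ^- 2 * (V (fun B B' => [disjoint B & B']%bool) X +
              V (fun B B' => ~~ [disjoint B & B']%bool) X).
  rewrite -square_sum_pairs sumrB sumr_const -cardsE card_draws card_ord.
  rewrite -[_ *+ 'C(n, _)]mulr_natl tauE -/N.
  set U := \sum_(B | _) _; field; exact: lt0r_neq0.
under eq_Rintegral do rewrite tauV.
rewrite RintegralZl//; last exact: (integrableD _ (intV _) (intV _)).
rewrite RintegralD// 2!VE big1 ?add0r; last first.
  move=> B B2; apply: big1 => B' /andP[B'2 dBB']; exact: covariance_disjoint.
have le4 : \sum_(B : {set 'I_n} | #|B| == 2)
    \sum_(B' : {set 'I_n} | (#|B'| == 2) && ~~ [disjoint B & B']%bool)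
    \int[iid_law D n]_X (centered_h p q X B * centered_h p q X B') <=
    N * (N - M) * 4.
  rewrite -sum_overlap_pairs_cst.
  apply: ler_sum => B B2; apply: ler_sum => B' /andP[B'2 _].
  rewrite -[leRHS](probability_Rintegral_cst _ _ _ (iid_law D n)).
  apply: le_Rintegral => //; first exact: integrable_centered_hM.
    exact: probability_integrable_cst.
  move=> X _; rewrite (le_trans (ler_norm _))// normrM.
  by rewrite (_ : 4 = 2 * 2 :> R) ?ler_pM ?centered_h_le2// -natrM.
rewrite mulrC ler_pdivrMr ?exprn_gt0// (le_trans le4)//.
rewrite binB2// NE.
(* The claim becomes 2 n (n - 1) (2 n - 3) <= 4 n (n - 1)^2, that is 2 n - 3 <= 2 (n - 1) up to a
   nonnegative factor. *)
have -> : 16 / n%:R * (n%:R * (n%:R - 1) / 2) ^+ 2 =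
    4 * n%:R * (n%:R - 1) ^+ 2 :> R by field; rewrite gt_eqF//; lra.
nra.
Qed.
End variance.

(** * Power bound at a fixed sample size *)

Section power.
Context {R : realType} {m n : nat} (D : probability (m.-tuple R) R).
Implicit Types (p q : 'I_m) (X : n.-tuple (m.-tuple R)).

Definition tau_error X : R :=
  \sum_(p < m) \sum_(q < m | (p < q)%N) (tau X p q - theta_tau D p q) ^+ 2.

Lemma tau_error_ge0 X : 0 <= tau_error X.
Proof. by do 2 apply: sumr_ge0 => ? _; exact: sqr_ge0. Qed.

Lemma integrable_tau_error_pair p q :
  (iid_law D n).-integrable setT
    (EFin \o fun X => (tau X p q - theta_tau D p q) ^+ 2).
Proof.
pose b : R := `|'C(n, 2)%:R^-1| * \sum_(B : {set 'I_n} | #|B| == 2) 1 + 1.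
have tb X : `|tau X p q - theta_tau D p q| <= b.
  rewrite (le_trans (ler_normB _ _))// lerD ?theta_tau_le1//.
  rewrite tauE normrM ler_wpM2l// (le_trans (ler_norm_sum _ _ _))//.
  by apply: ler_sum => B; exact: h_le1.
apply: (@bounded_measurable_integrable _ _ _ _ _ (b ^+ 2)).
  by apply: measurable_funX; apply: measurable_funB => //; exact: measurable_tau.
by move=> X; rewrite normrX lerXn2r// ?nnegrE// (le_trans _ (tb X)).
Qed.

Lemma integrable_tau_error : (iid_law D n).-integrable setT (EFin \o tau_error).
Proof.
rewrite (_ : _ \o _ = fun X => (\sum_(p < m) \sum_(q < m | (p < q)%N)
    ((tau X p q - theta_tau D p q) ^+ 2)%:E)%E); last first.
  apply/funext => X /=; rewrite -sumEFin; apply: eq_bigr => p _.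
  by rewrite -sumEFin.
apply: integrable_sum => // p _; apply: integrable_sum => // q _.
exact: integrable_tau_error_pair.
Qed.

Lemma sum_pairs_cst (c : R) :
  \sum_(p < m) \sum_(q < m | (p < q)%N) c = 'C(m, 2)%:R * c.
Proof.
by rewrite (sum_pairs _ (fun=> c)) sumr_const -cardsE card_draws card_ord mulr_natl.
Qed.

Lemma expected_tau_error : (2 <= n)%N ->
  \int[iid_law D n]_X tau_error X <= 'C(m, 2)%:R * (16 / n%:R).
Proof.
move=> n2; rewrite /tau_error -sum_pairs_cst.
have ip p : (iid_law D n).-integrable setT (EFin \o fun X =>
    \sum_(q < m | (p < q)%N) (tau X p q - theta_tau D p q) ^+ 2).
  rewrite (_ : _ \o _ = fun X => (\sum_(q < m | (p < q)%N)
    ((tau X p q - theta_tau D p q) ^+ 2)%:E)%E); last first.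
    by apply/funext => X /=; rewrite -sumEFin.
  by apply: integrable_sum => // q _; exact: integrable_tau_error_pair.
rewrite Rintegral_sum//; apply: ler_sum => p _.
rewrite Rintegral_sum//; last by move=> q; exact: integrable_tau_error_pair.
by apply: ler_sum => q _; exact: tau_variance.
Qed.

(** Coordinatewise, t^2 + (t - th)^2 - th^2 / 2 is the square (2 t - th)^2 / 2. *)
Lemma sqr_norm_Theta_le X :
  norm_Theta D ^+ 2 / 2 - tau_error X <=
  \sum_(p < m) \sum_(q < m | (p < q)%N) tau X p q ^+ 2.
Proof.
rewrite sqr_sqrtr; last by do 2 apply: sumr_ge0 => ? _; exact: sqr_ge0.
rewrite lerBlDr mulr_suml -big_split; apply: ler_sum => p _.
rewrite mulr_suml -big_split; apply: ler_sum => q _ /=.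
set t := tau _ _ _; set th := theta_tau _ _ _.
have := sqr_ge0 (2 * t - th); nra.
Qed.

(* Pointwise, 1 - tau_error / a <= test. *)
Lemma power_ge (alpha a : R) (W : n.-tuple (m.-tuple R) -> R) :
  measurable_fun setT W -> 0 < a -> (2 <= n)%N ->
  (forall X, tau_error X <= a ->
    4 * m%:R / (9 * n%:R) * normal_quantile (1 - alpha) <= W X) ->
  ((1 - 'C(m, 2)%:R * (16 / n%:R) / a)%:E <= 'E_(iid_law D n)[test alpha W])%E.
Proof.
move=> mW a0 n2 WX.
have itest : (iid_law D n).-integrable setT (EFin \o test alpha W).
  apply: (@bounded_measurable_integrable _ _ _ _ _ 1); last first.
    by move=> X; rewrite /test; case: ifP; rewrite ?normr1 ?normr0.
  by apply: measurable_fun_ifT => //; exact: measurable_fun_ler.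
have i1 : (iid_law D n).-integrable setT (EFin \o fun=> 1 : R).
  exact: probability_integrable_cst.
have ie : (iid_law D n).-integrable setT (EFin \o fun X => a^-1 * tau_error X).
  rewrite (_ : _ \o _ = fun X => (a^-1%:E * (tau_error X)%:E)%E)//.
  exact: (integrableZl _ _ integrable_tau_error).
rewrite unlock -[leRHS]fineK; last exact: integrable_fin_num itest.
rewrite lee_fin.
apply: (@le_trans _ _ (\int[iid_law D n]_X (1 - a^-1 * tau_error X))).
  rewrite RintegralB// probability_Rintegral_cst lerB//.
  rewrite RintegralZl//; last exact: integrable_tau_error.
  by rewrite mulrC ler_pM2r ?invr_gt0// expected_tau_error.
apply: le_Rintegral => //; first exact: (integrableB _ i1 ie).
move=> X _; rewrite /test; case: ifPn => [_|WN].
  by rewrite gerBl mulr_ge0 ?tau_error_ge0// invr_ge0 ltW.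
(* Without rejection the hypothesis on [W] forces [tau_error X] above [a], so the lower bound is
   negative. *)
rewrite subr_le0 mulrC ler_pdivlMr// mul1r ltW// ltNge.
by apply: contra WN => /WX.
Qed.

Lemma T_tau_ge X : (7 <= n)%N ->
  \sum_(p < m) \sum_(q < m | (p < q)%N) tau X p q ^+ 2 -
    'C(m, 2)%:R * (8 / n%:R) <= T_tau X.
Proof.
move=> n7; rewrite -sum_pairs_cst -sumrB; apply: ler_sum => p _.
by rewrite -sumrB; apply: ler_sum => q _; exact: tau_sqr_le.
Qed.

(** The true order is 4 / (9 n). The cruder 8 / n is the loss already met in [tau_sqr_le], so that
    both statistics obey the same lower bound. *)
Lemma mu_tau_le : (7 <= n)%N -> @mu_tau R n <= 8 / n%:R.
Proof.
move=> n7; have nR7 : 7 <= n%:R :> R by rewrite (ler_nat R 7).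
rewrite /mu_tau ler_pdivrMr; last by nra.
have -> : 8 / n%:R * (9 * n%:R * (n%:R - 1)) = 72 * (n%:R - 1) :> R.
  by field; rewrite gt_eqF//; lra.
lra.
Qed.

Lemma S_tau_ge X : (7 <= n)%N ->
  \sum_(p < m) \sum_(q < m | (p < q)%N) tau X p q ^+ 2 -
    'C(m, 2)%:R * (8 / n%:R) <= S_tau X.
Proof. by move=> n7; rewrite /S_tau lerB// ler_wpM2l// mu_tau_le. Qed.

End power.

(** * Passage to the limit and choice of the constants *)

Lemma limn_einf_gt (R : realType) (u : (\bar R)^nat) (b c : \bar R) :
  (b < c)%E -> (\forall n \near \oo, c <= u n)%E -> (b < limn_einf u)%E.
Proof.
(* An eventual bound survives in the limit only in its weak form; strictness comes from the gap
   between [b] and [c]. *)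
move=> bc cu; apply: (lt_le_trans bc).
rewrite limn_einf_lim; apply: lime_ge; first exact: is_cvg_einfs.
case: cu => k _ cu; exists k => // i ki.
by apply: le_ereal_inf_tmp => _ [j /= ij <-]; apply: cu; exact: leq_trans ij.
Qed.

(** The argument common to both statistics. In the constant, the first term times n is the level
    allowed to [tau_error], 16 gamma^2 n covers the loss C(m, 2) 8 / n, the final 1 pays for the
    rejection threshold, and the factor 2 undoes the halving in [sqr_norm_Theta_le]. *)
Lemma limn_einf_worst_power_gt (R : realType) (alpha beta gamma : R)
    (W : forall m n, n.-tuple (m.-tuple R) -> R) (m : nat -> nat)
    (F : forall k, set (probability (k.-tuple R) R)) :
  beta < 1 -> 0 < gamma ->
  (m n)%:R / n%:R @[n --> \oo] --> gamma ->
  (forall m n, measurable_fun setT (W m n)) ->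
  (forall m n (X : n.-tuple (m.-tuple R)), (7 <= n)%N ->
    \sum_(p < m) \sum_(q < m | (p < q)%N) tau X p q ^+ 2
      - 'C(m, 2)%:R * (8 / n%:R) <= W m n X) ->
  (beta%:E < limn_einf (fun n => worst_power (F (m n)) alpha
    (Num.sqrt (2 * (64 * gamma ^+ 2 / (1 - beta) + 16 * gamma ^+ 2 + 1)) *
      Num.sqrt n%:R)
    (W (m n) n)))%E.
Proof.
move=> beta1 gamma0 mgamma mW Wge.
set z := normal_quantile (1 - alpha).
(* Eventually C(m, 2) <= 2 gamma^2 n^2, so the expected error is at most 32 gamma^2 n; divided by
   [K * n] this is (1 - beta) / 2. *)
set K := 64 * gamma ^+ 2 / (1 - beta).
have K0 : 0 < K by rewrite divr_gt0 ?subr_gt0// mulr_gt0// exprn_gt0.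
have g20 : 0 < gamma ^+ 2 by rewrite exprn_gt0.
(* The midpoint of beta and 1 is the power guaranteed by the level [K * n]. *)
apply: (@limn_einf_gt _ _ _ ((1 + beta) / 2)%:E); first by rewrite lte_fin; lra.
near=> n.
have n7 : (7 <= n)%N by near: n; exact: nbhs_infty_ge.
have nR7 : 7 <= n%:R :> R by rewrite (ler_nat R 7).
have n0 : 0 < n%:R :> R by lra.
have mn : (m n)%:R <= 2 * gamma * n%:R.
  rewrite -ler_pdivrMr//; near: n.
  apply: (cvgr_le gamma mgamma); lra.
(* As m <= 2 gamma n, the rejection threshold is at most this constant, which [n] eventually
   exceeds. *)
have nz : 8 / 9 * gamma * `|z| <= n%:R by near: n; exact: nbhs_infty_ger.
have C2 : 'C(m n, 2)%:R <= 2 * gamma ^+ 2 * n%:R ^+ 2.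
  rewrite natr_bin2.
  have : (m n)%:R ^+ 2 <= (2 * gamma * n%:R) ^+ 2.
    by rewrite lerXn2r ?nnegrE ?mulr_ge0// ltW.
  have : 0 <= (m n)%:R :> R by [].
  nra.
apply: le_ereal_inf_tmp => _ [D [_ normD] <-].
have Kn0 : 0 < K * n%:R by rewrite mulr_gt0.
apply: le_trans (@power_ge _ _ _ D alpha (K * n%:R) _ (mW _ _) Kn0 _ _).
- rewrite lee_fin lerBrDl -lerBrDr ler_pdivrMr// mulrA ler_pdivrMr//.
  have -> : (1 - (1 + beta) / 2) * (K * n%:R) * n%:R =
      32 * gamma ^+ 2 * n%:R ^+ 2.
    by rewrite /K; field; lra.
  lra.
- exact: leq_trans n7.
- move=> X ZX; apply: le_trans (Wge _ _ X n7).
  have := sqr_norm_Theta_le D X.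
  have : 2 * (K + 16 * gamma ^+ 2 + 1) * n%:R <= norm_Theta D ^+ 2.
    rewrite -[X in X * _ <= _]sqr_sqrtr; last by lra.
    rewrite -[X in _ * X <= _]sqr_sqrtr// -exprMn.
    by rewrite lerXn2r ?nnegrE ?mulr_ge0 ?sqrtr_ge0.
  have : 4 * (m n)%:R / (9 * n%:R) * z <= n%:R.
    apply: le_trans nz; rewrite (le_trans (ler_norm _))// normrM ler_wpM2r//.
    rewrite ger0_norm; last by rewrite divr_ge0 ?mulr_ge0.
    by rewrite ler_pdivrMr; lra.
  have : 'C(m n, 2)%:R * (8 / n%:R) <= 16 * gamma ^+ 2 * n%:R.
    rewrite mulrA ler_pdivrMr//; lra.
  set s := \sum_(_ < _) _; set c := 'C(_, _)%:R * _; set t := _ * z.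
  move: ZX; set e := tau_error _ _; nra.
Unshelve. all: by end_near. Qed.

Theorem theorem5p1 (R : realType) (alpha beta gamma : R)
    (alpha_gt0 : 0 < alpha) (alpha_lt_beta : alpha < beta) (beta_lt1 : beta < 1)
    (gamma_gt0 : 0 < gamma) :
  exists C1 C2 : R, [/\ 0 < C1, 0 < C2 &
    forall (m : nat -> nat) (F : forall k, set (probability (k.-tuple R) R)),
    (m n)%:R / n%:R @[n --> \oo] --> gamma ->
    (forall k (D : probability (k.-tuple R) R),
      F k D -> continuous_distribution D) ->
    (forall k (D : probability (k.-tuple R) R),
      nondegenerate_gaussian D -> F k D) ->
    (beta%:E < limn_einf (fun n =>
       worst_power (F (m n)) alpha (C1 * Num.sqrt n%:R)
         (@S_tau R (m n) n)))%E /\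
    (beta%:E < limn_einf (fun n =>
       worst_power (F (m n)) alpha (C2 * Num.sqrt n%:R)
         (@T_tau R (m n) n)))%E].
Proof.
pose C := Num.sqrt (2 * (64 * gamma ^+ 2 / (1 - beta) + 16 * gamma ^+ 2 + 1)).
have C0 : 0 < C.
  have K0 : 0 < 64 * gamma ^+ 2 / (1 - beta).
    by rewrite divr_gt0 ?subr_gt0// mulr_gt0// exprn_gt0.
  by have := exprn_gt0 2 gamma_gt0; rewrite sqrtr_gt0; lra.
(* One constant suits both statistics, since they share the lower bound in terms of [tau]. *)
exists C, C; split=> // m F mgamma _ _; split.
- apply: (@limn_einf_worst_power_gt R alpha beta gamma (@S_tau R)) => //.
    by move=> *; exact: measurable_S_tau.
  by move=> *; exact: S_tau_ge.
- apply: (@limn_einf_worst_power_gt R alpha beta gamma (@T_tau R)) => //.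
    by move=> *; exact: measurable_T_tau.
  by move=> *; exact: T_tau_ge.
Qed.
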